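(* Let $G$ be a simple graph and let $e=v_iv_j$ be a non-pendent edge of $G$ (neither $v_i$ nor $v_j$ has degree $1$). If either (i) $\max\left\{\dfrac{d_i}{d_{\min}^{(i)}},\dfrac{d_j}{d_{\min}^{(j)}}\right\}\le 1$, or (ii) $\max\left\{\dfrac{d_i}{d_j},\dfrac{d_j}{d_i}\right\}\le \min\left\{\dfrac{d_i-\frac12}{d_{\max}^{(i)}},\dfrac{d_j-\frac12}{d_{\max}^{(j)}}\right\}$, then $GA(G)>GA(G-e)$.
   Context: $d_k$ denotes the degree of vertex $v_k$ in $G$, and $N(v)$ the neighbourhood of $v$. For the edge $v_iv_j$: $d_{\min}^{(j)}=\min\{d_k : v_k\in N(v_j)\setminus\{v_i\}\}$, $d_{\max}^{(j)}=\max\{d_k : v_k\in N(v_j)\setminus\{v_i\}\}$, and symmetrically $d_{\min}^{(i)}=\min\{d_k : v_k\in N(v_i)\setminus\{v_j\}\}$, $d_{\max}^{(i)}=\max\{d_k : v_k\in N(v_i)\setminus\{v_j\}\}$ (degrees in $G$). The first geometric-arithmetic index is $GA(H)=\sum_{uv\in E(H)}\frac{2\sqrt{d_H(u)d_H(v)}}{d_H(u)+d_H(v)}$, with degrees taken in $H$; $G-e$ is $G$ with edge $e$ deleted. *)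

(* Defs.v *)
From mathcomp Require Import all_boot all_order all_algebra reals.

Set Implicit Arguments.
Unset Strict Implicit.
Unset Printing Implicit Defensive.

Import Order.TTheory GRing.Theory Num.Theory.
Local Open Scope ring_scope.

Record sgraph (T : finType) := SGraph {
  adj : rel T;
  adj_sym : symmetric adj;
  adj_irr : irreflexive adj }.

Definition nbh (T : finType) (G : sgraph T) (v : T) : {set T} :=
  [set w | adj G v w].

Definition deg (T : finType) (G : sgraph T) (v : T) : nat := #|nbh G v|.

Definition edges (T : finType) (G : sgraph T) : {set {set T}} :=
  [set [set p.1; p.2] | p : T * T & adj G p.1 p.2].

Definition del_adj (T : finType) (G : sgraph T) (u v : T) : rel T :=
  fun x y => adj G x y && ([set x; y] != [set u; v]).

Lemma del_adj_sym (T : finType) (G : sgraph T) (u v : T) :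
  symmetric (del_adj G u v).
Proof. by move=> x y; rewrite /del_adj adj_sym setUC. Qed.

Lemma del_adj_irr (T : finType) (G : sgraph T) (u v : T) :
  irreflexive (del_adj G u v).
Proof. by move=> x; rewrite /del_adj adj_irr. Qed.

Definition del_edge (T : finType) (G : sgraph T) (u v : T) : sgraph T :=
  SGraph (del_adj_sym G u v) (del_adj_irr G u v).

(* An edge is a set a = {u, v} with u != v, so the product and the sum over a
   are d(u) d(v) and d(u) + d(v); see GA_term_edge. *)
Definition GA_term (R : realType) (T : finType) (G : sgraph T) (a : {set T})
    : R :=
  2 * Num.sqrt (\prod_(u in a) (deg G u)%:R) / \sum_(u in a) (deg G u)%:R.

Definition GA (R : realType) (T : finType) (G : sgraph T) : R :=
  \sum_(a in edges G) GA_term R G a.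

Lemma GA_term_edge (R : realType) (T : finType) (G : sgraph T) (u v : T) :
  adj G u v ->
  GA_term R G [set u; v] =
    2 * Num.sqrt ((deg G u)%:R * (deg G v)%:R)
      / ((deg G u)%:R + (deg G v)%:R).
Proof.
move=> uv; have nuv : u \notin [set v].
  by rewrite in_set1; apply: contraTneq uv => ->; rewrite adj_irr.
by rewrite /GA_term !big_setU1 ?big_set1.
Qed.

Lemma edges_del_edge (T : finType) (G : sgraph T) (u v : T) :
  edges (del_edge G u v) = edges G :\ [set u; v].
Proof.
apply/setP => a; rewrite in_setD1; apply/imsetP/andP.
  by move=> [[x y]]; rewrite inE /= => /andP[xy ne] ->; split=> //;
    apply/imsetP; exists (x, y); rewrite ?inE.
move=> [ne /imsetP[[x y]]]; rewrite inE /= => xy def_a.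
by exists (x, y); rewrite // inE /= /del_adj xy -def_a.
Qed.

(* Minimum and maximum degree in G over N(v) \ {w}.  Degrees are below #|T|,
   so the default value #|T| matters only when that set is empty. *)
Definition dmin (T : finType) (G : sgraph T) (v w : T) : nat :=
  \big[minn/#|T|]_(x in nbh G v :\ w) deg G x.

Definition dmax (T : finType) (G : sgraph T) (v w : T) : nat :=
  \max_(x in nbh G v :\ w) deg G x.

(* Main.v *)
(** Put f(p,q) = 2 sqrt(pq)/(p+q), a = d_i and b = d_j.  Deleting the edge
    changes only the terms of the other edges at v_i and at v_j, so it
    suffices that the a - 1 remaining edges at v_i gain together less than
    f(a,b)/2, and likewise at v_j.  Under (i), f(x,d) is nondecreasing in x up
    to d, so nothing is gained.  Under (ii), put m = a - 1/2; for a neighbour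
    of degree d the hypothesis gives d <= a - 1 and f(m,d) <= f(a,b), while
    (a-1) (f(a-1,d) - f(a,d)) < f(m,d)/2 by an elementary estimate. *)
Require Import Defs.
From mathcomp Require Import all_boot all_order all_algebra reals.
From mathcomp Require Import ring lra.
Import Order.TTheory GRing.Theory Num.Theory.
Local Open Scope ring_scope.

Set Implicit Arguments.
Unset Strict Implicit.
Unset Printing Implicit Defensive.

(** * Real estimates for a single edge term *)

Definition ga (R : realType) (p q : R) : R := 2 * Num.sqrt (p * q) / (p + q).

Lemma gaC (R : realType) (p q : R) : ga p q = ga q p.
Proof. by rewrite /ga [p * q]mulrC [p + q]addrC. Qed.

Lemma ga_gt0 (R : realType) (p q : R) : 0 < p -> 0 < q -> 0 < ga p q.
Proof.
by move=> p0 q0; rewrite /ga divr_gt0 ?addr_gt0 ?mulr_gt0 ?sqrtr_gt0 ?mulr_gt0.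
Qed.

(** [ga] depends only on the ratio of its arguments and decreases as this ratio moves away from 1;
    the hypothesis says that [m : d] is at least as far from 1 as [p : q]. After squaring, the
    difference of the two sides is exactly the product assumed nonnegative. *)
Lemma ga_le (R : realType) (m d p q : R) :
  0 < m -> 0 < d -> 0 < p -> 0 < q ->
  0 <= (p * m - q * d) * (q * m - p * d) -> ga m d <= ga p q.
Proof.
move=> m0 d0 p0 q0 h.
rewrite /ga ler_pdivrMr ?addr_gt0 // mulrAC ler_pdivlMr ?addr_gt0 //.
rewrite -!mulrA ler_pM2l // -ler_sqr ?nnegrE; last 2 first.
- by rewrite mulr_ge0 ?sqrtr_ge0 ?addr_ge0 ?ltW.
- by rewrite mulr_ge0 ?sqrtr_ge0 ?addr_ge0 ?ltW.
rewrite !exprMn !sqr_sqrtr; [|by rewrite mulr_ge0 ?ltW..].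
rewrite -subr_ge0.
suff -> : p * q * (m + d) ^+ 2 - m * d * (p + q) ^+ 2
          = (p * m - q * d) * (q * m - p * d) by [].
ring.
Qed.

(** Clearing denominators and dividing by [e] leaves [main], the product of two separate bounds: one
    on [2 * x * (t - s)], one on the remaining factor. *)
Lemma ga_drop (R : realType) (x d : R) :
  1 <= d -> d <= x -> x * (ga x d - ga (x + 1) d) < ga (x + 1 / 2) d / 2.
Proof.
move=> d1 dx.
have [d0 x0 y0 m0] : [/\ 0 < d, 0 < x, 0 < x + 1 & 0 < x + 1 / 2] by split; lra.
rewrite /ga !sqrtrM ?ltW //.
set s := Num.sqrt x; set t := Num.sqrt (x + 1).
set w := Num.sqrt (x + 1 / 2); set e := Num.sqrt d.
have s0 : 0 < s by rewrite sqrtr_gt0.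
have e0 : 0 < e by rewrite sqrtr_gt0.
have ss : s ^+ 2 = x by rewrite sqr_sqrtr // ltW.
have tt : t ^+ 2 = x + 1 by rewrite sqr_sqrtr // ltW.
have st : s <= t by rewrite ler_wsqrtr //; lra.
have sw : s <= w by rewrite ler_wsqrtr //; lra.
have dst : d <= s * t by rewrite (le_trans dx) // -ss expr2 ler_pM2l.
have stm : s * t <= x + 1 / 2.
  have := sqr_ge0 (t - s); rewrite sqrrB ss tt mulrC -mulr_natr; lra.
(* The factor t - s is removed through t - s = 1 / (t + s) <= 1 / (2 s). *)
have drop_s : 2 * x * (t - s) <= w.
  apply: le_trans sw.
  have -> : 2 * x * (t - s) = s * (2 * s * (t - s)) by rewrite -ss; ring.
  rewrite ler_piMr ?(ltW s0) //.
  have : (t + s) * (t - s) = 1 by rewrite mulrC -subr_sqr tt ss; ring.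
  nra.
have main : 2 * x * (t - s) * ((s * t - d) * (x + 1 / 2 + d))
            < w * ((x + d) * (x + 1 + d)).
  (* By [stm] the left side is at most [(x + 1 / 2) ^+ 2 - d ^+ 2]. *)
  have le1 : (s * t - d) * (x + 1 / 2 + d) < (x + d) * (x + 1 + d) by nra.
  apply: le_lt_trans (_ : w * ((s * t - d) * (x + 1 / 2 + d)) < _).
    by rewrite ler_wpM2r // mulr_ge0; lra.
  by rewrite ltr_pM2l // (lt_le_trans s0).
rewrite -subr_gt0.
have -> : 2 * (w * e) / (x + 1 / 2 + d) / 2 -
   x * (2 * (s * e) / (x + d) - 2 * (t * e) / (x + 1 + d)) =
   e * (w * ((x + d) * (x + 1 + d))
        - 2 * x * (t - s) * ((s * t - d) * (x + 1 / 2 + d)))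
   / ((x + 1 / 2 + d) * (x + d) * (x + 1 + d)).
  have num : s * (x + 1 + d) - t * (x + d) = (t - s) * (s * t - d).
    rewrite -{2}ss -tt; ring.
  rewrite -[2 * x * _ * _]mulrA [(t - s) * _]mulrA -num.
  field; rewrite !gt_eqF //; lra.
by rewrite divr_gt0 ?mulr_gt0 ?subr_gt0 //; lra.
Qed.

(** What (i) or (ii) says about one neighbour of degree [d] of an endpoint of degree [a], [b] being
    the degree of the other endpoint; for (ii), denominators are cleared. *)
Definition mild_degree (R : realType) (a b d : nat) : Prop :=
  (a <= d)%N \/
  (a%:R * d%:R <= (a%:R - 1 / 2) * b%:R :> R) /\
  (b%:R * d%:R <= (a%:R - 1 / 2) * a%:R :> R).

Lemma ga_loss_lt (R : realType) (x b d : nat) :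
  (0 < x)%N -> (0 < b)%N -> (0 < d)%N -> mild_degree R x.+1 b d ->
  x%:R * (ga x%:R d%:R - ga x.+1%:R d%:R) < ga x.+1%:R b%:R / 2 :> R.
Proof.
move=> x0 b0 d0 h.
have X0 : 0 < x%:R :> R by rewrite ltr0n.
have D0 : 1 <= d%:R :> R by rewrite ler1n.
have B0 : 0 < b%:R :> R by rewrite ltr0n.
have xS : x.+1%:R = x%:R + 1 :> R by rewrite -natr1.
case: h => [xd | []].
  have XD : x%:R + 1 <= d%:R :> R by rewrite natr1 ler_nat.
  apply: (@le_lt_trans _ _ 0); last by rewrite divr_gt0 ?ga_gt0 ?ltr0n.
  rewrite pmulr_rle0 // subr_le0 ga_le ?ltr0n // xS.
  have -> : d%:R * x%:R - (x%:R + 1) * d%:R = - d%:R :> R by ring.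
  by rewrite mulr_le0 ?oppr_le0 // subr_le0 ler_pM //; lra.
rewrite xS => h1 h2.
(* Adding [h1] and [h2] and dividing by [a + b] gives [d <= a - 1 / 2] with [a = x + 1]; integrality
   then gives [d <= x]. *)
have dx : (d <= x)%N.
  rewrite -ltnS -(ltr_nat R) xS.
  nra.
have DX : d%:R <= x%:R :> R by rewrite ler_nat.
apply: lt_le_trans (@ga_drop R _ _ D0 DX) _.
(* With [m = x + 1 / 2], the two factors required by [ga_le] are nonnegative by [h2] and [h1]
   respectively. *)
rewrite ler_pM2r ?invr_gt0 // ga_le //; try lra.
by rewrite mulr_ge0 //; lra.
Qed.

(** * Degrees, and sums over the edges at a vertex *)

Section Degrees.
Variables (R : realType) (T : finType) (G : sgraph T).

Lemma deg_gt0 (u v : T) : adj G u v -> (0 < deg G u)%N.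
Proof. by move=> uv; rewrite /deg card_gt0; apply/set0Pn; exists v; rewrite inE. Qed.

Lemma dmin_le (u v k : T) : k \in nbh G u :\ v -> (dmin G u v <= deg G k)%N.
Proof.
move=> kin; rewrite /dmin.
elim: (index_enum T) (mem_index_enum k) => //= l s IHs.
rewrite in_cons big_cons; case/predU1P => [<-|/IHs le_s].
  by rewrite kin geq_minl.
by case: ifP => // _; apply: leq_trans (geq_minr _ _) le_s.
Qed.

Lemma dmin_gt0 (u v : T) : (0 < dmin G u v)%N.
Proof.
rewrite /dmin; elim/big_ind: _ => [|p q p0 q0|k].
(* The default [#|T|] is positive because [T] contains [u]. *)
- by apply/card_gt0P; exists u.
- by rewrite leq_min p0.
- by rewrite !inE => /andP[_]; rewrite adj_sym => /deg_gt0.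
Qed.

Lemma dmax_ge (u v k : T) : k \in nbh G u :\ v -> (deg G k <= dmax G u v)%N.
Proof. by move=> kin; rewrite /dmax (bigD1 k) //= leq_maxl. Qed.

(** The map from [k] to [[set v; k]] is a bijection from the neighbours of [v] to the edges at [v];
    injectivity uses that [v] is not its own neighbour. *)
Lemma sum_incident_edges (v : T) (F : {set T} -> R) :
  \sum_(a in edges G | v \in a) F a = \sum_(k in nbh G v) F [set v; k].
Proof.
rewrite -(@big_imset _ _ _ _ _ (fun k => [set v; k]) (mem (nbh G v)) F) /=.
  apply: eq_bigl => a; apply/andP/imsetP => [[/imsetP[[x y]]]|[k]].
    rewrite inE /= => xy ->; rewrite !inE => /orP[]/eqP->.
      by exists y; rewrite ?inE.
    by exists x; rewrite ?inE 1?adj_sym // setUC.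
  rewrite inE => vk ->; split; last by rewrite set21.
  by apply/imsetP; exists (v, k); rewrite ?inE.
move=> k l; rewrite !inE => vk vl /setP/(_ k).
rewrite !inE eqxx orbT => /esym/orP[]/eqP // kv.
by rewrite kv adj_irr in vk.
Qed.

Lemma sum_ga_loss_lt (u v : T) :
  adj G u v -> deg G u <> 1%N ->
  (forall k, k \in nbh G u :\ v -> mild_degree R (deg G u) (deg G v) (deg G k)) ->
  \sum_(k in nbh G u :\ v)
     (ga (deg G u).-1%:R (deg G k)%:R - ga (deg G u)%:R (deg G k)%:R)
  < ga (deg G u)%:R (deg G v)%:R / 2 :> R.
Proof.
move=> uv u1 hk.
have v0 : (0 < deg G v)%N by apply: (@deg_gt0 v u); rewrite adj_sym.
have cu : #|nbh G u :\ v| = (deg G u).-1.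
  by rewrite /deg [in RHS](cardsD1 v) inE uv.
have := deg_gt0 uv; case def_a: (deg G u) cu u1 hk => [//|x] /= cu u1 hk _.
(* Being non-pendent means that another edge remains at [u]: the sum is nonempty, so termwise strict
   bounds give a strict bound. *)
have x0 : (0 < x)%N by case: x u1 {def_a cu hk}.
rewrite -(@ltr_pM2l _ x%:R) ?ltr0n // mulr_sumr.
have -> : x%:R * (ga x.+1%:R (deg G v)%:R / 2)
          = \sum_(k in nbh G u :\ v) ga x.+1%:R (deg G v)%:R / 2 :> R.
  by rewrite sumr_const cu mulr_natl.
apply: ltr_sum => [|k kin].
  have /card_gt0P[k kin] : (0 < #|nbh G u :\ v|)%N by rewrite cu.
  by apply/hasP; exists k; rewrite ?mem_index_enum.
apply: ga_loss_lt => //; last exact: hk.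
by move: kin; rewrite !inE => /andP[_]; rewrite adj_sym => /deg_gt0.
Qed.

End Degrees.

(** * Effect of deleting an edge on neighbourhoods and on [GA] *)

Section DeleteEdge.
Variables (T : finType) (G : sgraph T) (u v : T).

Lemma nbh_del_edgel : adj G u v -> nbh (del_edge G u v) u = nbh G u :\ v.
Proof.
move=> uv; have uNv : u != v by apply: contraTneq uv => ->; rewrite adj_irr.
apply/setP => k; rewrite !inE /= /del_adj andbC; congr (_ && _); congr (~~ _).
apply/eqP/eqP => [/setP/(_ v)|->//].
by rewrite !inE eqxx orbT eq_sym (negPf uNv) /= => /eqP.
Qed.

Lemma nbh_del_edge_neq (k : T) :
  k != u -> k != v -> nbh (del_edge G u v) k = nbh G k.
Proof.
move=> ku kv; apply/setP => l; rewrite !inE /= /del_adj.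
have -> : [set k; l] != [set u; v]; last by rewrite andbT.
apply/negP => /eqP/setP/(_ k).
by rewrite !inE eqxx (negPf ku) (negPf kv).
Qed.

Lemma nbh_del_edgeC (k : T) : nbh (del_edge G u v) k = nbh (del_edge G v u) k.
Proof. by apply/setP => l; rewrite !inE /= /del_adj [[set v; u]]setUC. Qed.

End DeleteEdge.

Lemma GA_term_del_edge (R : realType) (T : finType) (G : sgraph T) (u v k : T) :
  adj G u v -> k \in nbh G u :\ v ->
  GA_term R (del_edge G u v) [set u; k] - GA_term R G [set u; k]
  = ga (deg G u).-1%:R (deg G k)%:R - ga (deg G u)%:R (deg G k)%:R.
Proof.
move=> uv kin.
have uk' : adj (del_edge G u v) u k.
  by move: (kin); rewrite -nbh_del_edgel // inE.
move: kin; rewrite !inE => /andP[kv uk].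
have ku : k != u by apply: contraTneq uk => ->; rewrite adj_irr.
have du : deg (del_edge G u v) u = (deg G u).-1.
  by rewrite /deg nbh_del_edgel // [in RHS](cardsD1 v) inE uv.
have dk : deg (del_edge G u v) k = deg G k by rewrite /deg nbh_del_edge_neq.
by rewrite !GA_term_edge // du dk.
Qed.

Lemma eq_GA_term (R : realType) (T : finType) (G H : sgraph T) (a : {set T}) :
  {in a, deg G =1 deg H} -> GA_term R G a = GA_term R H a.
Proof.
move=> eqd; rewrite /GA_term; congr (2 * Num.sqrt _ / _).
  by apply: eq_bigr => k /eqd ->.
by apply: eq_bigr => k /eqd ->.
Qed.

(** The remaining edges are split into those at [u], those at [v], and the others, whose terms
    cancel because their endpoints keep their degrees. *)
Lemma GA_del_edge (R : realType) (T : finType) (G : sgraph T) (u v : T) :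
  adj G u v ->
  GA R (del_edge G u v) - GA R G =
    \sum_(k in nbh G u :\ v)
       (ga (deg G u).-1%:R (deg G k)%:R - ga (deg G u)%:R (deg G k)%:R)
  + \sum_(k in nbh G v :\ u)
       (ga (deg G v).-1%:R (deg G k)%:R - ga (deg G v)%:R (deg G k)%:R)
  - ga (deg G u)%:R (deg G v)%:R.
Proof.
move=> uv; have vu : adj G v u by rewrite adj_sym.
have uvE : [set u; v] \in edges G by apply/imsetP; exists (u, v); rewrite ?inE.
set H := del_edge G u v.
have EH a : (a \in edges H) = (a \in edges G) && (a != [set u; v]).
  by rewrite /H edges_del_edge in_setD1 andbC.
rewrite {2}/GA (bigD1 [set u; v]) //= GA_term_edge // opprD addrA addrAC.
congr (_ - _).
rewrite /GA -(eq_bigl _ _ EH) -sumrB (bigID (fun a : {set T} => u \in a)) /=.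
rewrite sum_incident_edges nbh_del_edgel //; congr (_ + _).
  by apply: eq_bigr => k kin; rewrite GA_term_del_edge.
rewrite (bigID (fun a : {set T} => v \in a)) /= [X in _ + X]big1 ?addr0; last first.
  move=> a /andP[/andP[_ ua] va]; apply/eqP; rewrite subr_eq0; apply/eqP.
  apply: eq_GA_term => k ka; rewrite /deg nbh_del_edge_neq //.
    by apply: contraNneq ua => <-.
  by apply: contraNneq va => <-.
transitivity (\sum_(a in edges H | v \in a) (GA_term R H a - GA_term R G a)).
  apply: eq_bigl => a; rewrite -andbA; case aE: (a \in edges H) => //=.
  case va: (v \in a); rewrite ?andbF ?andbT //.
  apply/negP => ua; move: aE; rewrite EH => /andP[/imsetP[[x y]]].
  rewrite inE /= => _ def_a /eqP[]; move: ua va; rewrite def_a !inE.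
  have uNv : u != v by apply: contraTneq uv => ->; rewrite adj_irr.
  case/orP=> /eqP eu; case/orP=> /eqP ev //; rewrite ?eu ?ev //.
  - by rewrite eu ev eqxx in uNv.
  - by rewrite setUC.
  - by rewrite eu ev eqxx in uNv.
rewrite sum_incident_edges nbh_del_edgeC nbh_del_edgel //.
apply: eq_bigr => k kin; rewrite -(GA_term_del_edge R vu kin); congr (_ - _).
by apply: eq_GA_term => l _; rewrite /deg nbh_del_edgeC.
Qed.

(** * From the hypotheses (i) and (ii) to the conclusion *)

Lemma mild_degree_dmin (R : realType) (T : finType) (G : sgraph T) (u v k : T) :
  (deg G u)%:R / (dmin G u v)%:R <= 1 :> R ->
  k \in nbh G u :\ v -> mild_degree R (deg G u) (deg G v) (deg G k).
Proof.
rewrite ler_pdivrMr ?ltr0n ?dmin_gt0 // mul1r ler_nat => h /dmin_le kin.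
by left; apply: leq_trans h kin.
Qed.

Lemma mild_degree_dmax (R : realType) (T : finType) (G : sgraph T) (u v k : T) :
  adj G u v ->
  (deg G u)%:R / (deg G v)%:R <= ((deg G u)%:R - 1 / 2) / (dmax G u v)%:R :> R ->
  (deg G v)%:R / (deg G u)%:R <= ((deg G u)%:R - 1 / 2) / (dmax G u v)%:R :> R ->
  k \in nbh G u :\ v -> mild_degree R (deg G u) (deg G v) (deg G k).
Proof.
move=> uv h1 h2 kin; right.
have u0 : (0 < deg G u)%N by apply: deg_gt0 uv.
have v0 : (0 < deg G v)%N by apply: (@deg_gt0 _ _ v u); rewrite adj_sym.
have k0 : (0 < deg G k)%N.
  by move: kin; rewrite !inE => /andP[_]; rewrite adj_sym => /deg_gt0.
(* The neighbour [k] makes [dmax] positive, so the division by it is genuine and can be cleared. *)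
have kM := dmax_ge kin; have M0 := leq_trans k0 kM.
move: h1 h2; rewrite !ler_pdivrMr ?ltr0n // ![_ / _ * _]mulrAC.
rewrite !ler_pdivlMr ?ltr0n // => h1 h2.
by split; [apply: le_trans h1 | apply: le_trans h2];
  rewrite ler_wpM2l ?ler0n // ler_nat.
Qed.

Theorem theorem13 (R : realType) (T : finType) (G : sgraph T) (vi vj : T)
    (hij : adj G vi vj) (hi : deg G vi <> 1%N) (hj : deg G vj <> 1%N)
    (hcond :
      Num.max ((deg G vi)%:R / (dmin G vi vj)%:R)
              ((deg G vj)%:R / (dmin G vj vi)%:R) <= 1 :> R
      \/
      Num.max ((deg G vi)%:R / (deg G vj)%:R)
              ((deg G vj)%:R / (deg G vi)%:R)
      <= Num.min (((deg G vi)%:R - 1 / 2) / (dmax G vi vj)%:R)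
                 (((deg G vj)%:R - 1 / 2) / (dmax G vj vi)%:R) :> R) :
  GA R G > GA R (del_edge G vi vj).
Proof.
have hji : adj G vj vi by rewrite adj_sym.
have [mi mj] :
    (forall k, k \in nbh G vi :\ vj ->
       mild_degree R (deg G vi) (deg G vj) (deg G k)) /\
    (forall k, k \in nbh G vj :\ vi ->
       mild_degree R (deg G vj) (deg G vi) (deg G k)).
  case: hcond; rewrite ge_max.
    by case/andP=> h1 h2; split=> k; apply: mild_degree_dmin.
  rewrite !le_min => /andP[/andP[h1 h2] /andP[h3 h4]].
  split=> k; first exact: mild_degree_dmax hij h1 h3.
  exact: mild_degree_dmax hji h4 h2.
rewrite -subr_lt0 GA_del_edge //.
have := sum_ga_loss_lt hij hi mi; have := sum_ga_loss_lt hji hj mj.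
(* By symmetry of [ga], the two halves add up to the term of the deleted edge. *)
rewrite [ga (deg G vj)%:R (deg G vi)%:R]gaC.
lra.
Qed.
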